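(* Let $n\geq 1$ and $S,T\subseteq[n-1]$, and let $$A_{ST}=\#\{w\in\mathfrak{S}_n : \overline{S}\subseteq C(w),\ T\subseteq D(w)\}.$$ Then $A_{ST}=\eta(\overline{S})/\eta(\overline{T})$ if $\overline{S}\cap T=\emptyset$, and $A_{ST}=0$ otherwise.
   Context: $[n]=\{1,\dots,n\}$, $\mathfrak{S}_n$ is the set of permutations $w=a_1\cdots a_n$ of $[n]$. For $X\subseteq[n-1]$, $\overline{X}=[n-1]\setminus X$. The descent set is $D(w)=\{i : a_i>a_{i+1}\}$. The connectivity set is $C(w)=\{i\in[n-1] : a_j<a_k \text{ for all } j\leq i<k\}$. For $X=\{i_1<\cdots<i_k\}\subseteq[n-1]$, $\eta(X)=i_1!\,(i_2-i_1)!\cdots(i_k-i_{k-1})!\,(n-i_k)!$ (with $\eta(\emptyset)=n!$). *)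

(* Defs.v *)
From mathcomp Require Import all_boot all_order all_fingroup all_algebra.

Set Implicit Arguments.
Unset Strict Implicit.
Unset Printing Implicit Defensive.

(* Indices are shifted by one: k : 'I_n stands for the element k.+1 of [n], so
   w : 'S_n is the word a_1 ... a_n with a_(k.+1) = (w k).+1, and i : 'I_n.-1
   stands for the element i.+1 of [n-1]. *)

Lemma succ_pos_subproof (n : nat) (i : 'I_n.-1) : i.+1 < n.
Proof. by rewrite -ltn_predRL. Qed.

(* The 0-based positions of a_(i.+1) and a_(i.+2). *)
Definition pos (n : nat) (i : 'I_n.-1) : 'I_n := widen_ord (leq_pred n) i.
Definition succ_pos (n : nat) (i : 'I_n.-1) : 'I_n :=
  Ordinal (succ_pos_subproof i).

Definition descent_set (n : nat) (w : 'S_n) : {set 'I_n.-1} :=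
  [set i | w (succ_pos i) < w (pos i)].

(* With both indices shifted, j.+1 <= i.+1 < k.+1 reads j <= i < k. *)
Definition connectivity_set (n : nat) (w : 'S_n) : {set 'I_n.-1} :=
  [set i : 'I_n.-1 | [forall j : 'I_n, forall k : 'I_n,
                        (j <= i < k) ==> (w j < w k)]].

(* [enum X] is increasing, so for X = {i_1 < ... < i_k} (1-based) the product
   runs over i_1 - 0, i_2 - i_1, ..., i_k - i_(k-1), n - i_k. *)
Definition eta (n : nat) (X : {set 'I_n.-1}) : nat :=
  \prod_(d <- pairmap (fun a b => b - a) 0
                (rcons [seq i.+1 | i : 'I_n.-1 <- enum X] n)) d`!.

Definition A_ST (n : nat) (S T : {set 'I_n.-1}) : nat :=
  #|[set w : 'S_n | (~: S \subset connectivity_set w)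
                    && (T \subset descent_set w)]|.

(* Main.v *)
(** The condition [X \subset C(w)] says that [w] lies in the Young subgroup
    [young X] preserving every initial segment cut off by [X], whose order is
    [eta X].  If [T \subset S], then [young (~: T)] is a subgroup
    of [young (~: S)], and each of its cosets contains exactly one permutation
    that decreases along every maximal run of [T].  So [A_ST S T] is the index of
    [young (~: T)] in [young (~: S)]. *)
Require Import Defs.
From mathcomp Require Import all_boot all_order all_fingroup all_algebra.
From mathcomp Require Import zify.

Set Implicit Arguments.
Unset Strict Implicit.
Unset Printing Implicit Defensive.

Import GroupScope.

(** * Initial segments, connectivity sets and Young subgroups *)

Definition initial_segment (n c : nat) : {set 'I_n} := [set j : 'I_n | j < c].

Lemma card_initial_segment n c : c <= n -> #|initial_segment n c| = c.
Proof.
move=> cn; rewrite -sum1_card (eq_bigl (fun j : 'I_n => j < c)).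
  by rewrite (big_ord_narrow cn) sum1_card card_ord.
by move=> j; rewrite inE.
Qed.

(** Written as a setwise stabilizer for the natural action, so that closure under products and
    inverses comes from its canonical group structure. *)
Definition segment_stab (n c : nat) : {set 'S_n} :=
  'N(initial_segment n c | 'P).

(** An injective map of a finite set into itself is onto, so one inclusion suffices. *)
Lemma segment_stab_sub n c (w : 'S_n) :
  (forall j : 'I_n, j < c -> w j < c) -> w \in segment_stab n c.
Proof.
move=> h; rewrite /segment_stab !inE.
by apply/subsetP => j; rewrite !inE; apply: h.
Qed.

Lemma segment_stabP n c (w : 'S_n) :
  reflect (forall j : 'I_n, (w j < c) = (j < c)) (w \in segment_stab n c).
Proof.
apply: (iffP idP) => [/astabsP h j|h]; first by have := h j; rewrite !inE.
by apply: segment_stab_sub => j; rewrite h.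
Qed.

Lemma connectivityE n (w : 'S_n) (i : 'I_n.-1) :
  (i \in connectivity_set w) = (w \in segment_stab n i.+1).
Proof.
apply/idP/segment_stabP => [|h].
  rewrite inE => /forallP h.
  have {}h (j k : 'I_n) : j <= i -> i < k -> w j < w k.
    by move=> ji ik; have /forallP/(_ k)/implyP := h j; apply; rewrite ji ik.
  apply/segment_stabP; apply: segment_stab_sub => j; rewrite !ltnS => ji.
  case: leqP => // iwj.
  (* Given [j <= i < w j], a value [v <= i] taken at a position beyond [i] would satisfy [w j < v],
     which is absurd. So [w^-1] preserves the segment, and this contradicts [i < w j]. *)
  suff /segment_stabP/(_ (w j)) : w^-1 \in segment_stab n i.+1.
    by rewrite permK !ltnS ji leqNgt iwj.
  apply: segment_stab_sub => v; rewrite !ltnS => vi.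
  rewrite leqNgt; apply/negP => /(h _ _ ji); rewrite permKV => wjv.
  by have := leq_ltn_trans (leq_trans (ltnW wjv) vi) iwj; rewrite ltnn.
rewrite inE; apply/forallP => j; apply/forallP => k; apply/implyP => /andP[ji ik].
have := h j; have := h k; rewrite !ltnS ji (leqNgt k) ik leqNgt => /negbFE h1 h2.
exact: leq_ltn_trans h2 h1.
Qed.

Definition young (n : nat) (X : {set 'I_n.-1}) : {set 'S_n} :=
  \bigcap_(i in X) segment_stab n i.+1.

Canonical segment_stab_group n c := [group of segment_stab n c].
Canonical young_group n (X : {set 'I_n.-1}) := [group of young X].

Lemma youngE n (X : {set 'I_n.-1}) (w : 'S_n) :
  (w \in young X) = (X \subset connectivity_set w).
Proof.
apply/bigcapP/subsetP => h i iX; first by rewrite connectivityE h.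
by rewrite -connectivityE h.
Qed.

Lemma youngP n (X : {set 'I_n.-1}) (w : 'S_n) :
  reflect (forall i, i \in X -> forall j : 'I_n, (w j <= i) = (j <= i))
          (w \in young X).
Proof.
apply: (iffP bigcapP) => h i iX.
  by move=> j; have /segment_stabP/(_ j) := h i iX; rewrite !ltnS.
by apply/segment_stabP => j; rewrite !ltnS h.
Qed.

Lemma youngS n (X Y : {set 'I_n.-1}) : X \subset Y -> young Y \subset young X.
Proof.
by move=> /subsetP h; apply/subsetP => w /youngP wY; apply/youngP => i /h /wY.
Qed.

(** * Order of a Young subgroup *)

(** Induction on the list of cuts, for permutations fixing every position below [a]. With [c] the
    next cut, each one factors uniquely as [u * v], where [u] moves only the block [B] from [a] to
    [c] and [v] moves only positions from [c] on. *)
Lemma card_segment_stabs n a s : path leq a s -> last a s = n ->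
  #|[set w : 'S_n | perm_on [set j : 'I_n | a <= j] w
                    & all (fun c => w \in segment_stab n c) s]|
  = (\prod_(d <- pairmap (fun a b => b - a) a s) d`!)%N.
Proof.
elim: s a => [|c s IH] a /=.
  move=> _ ->; rewrite big_nil -(cards1 (1 : 'S_n)); congr #|pred_of_set _|.
  apply/setP => w; rewrite !inE andbT; apply/idP/eqP => [h|->]; last exact: perm_on1.
  by apply/permP => j; rewrite perm1 (out_perm h) // inE -ltnNge.
move=> /andP[ac pcs] lst; rewrite big_cons -(IH c pcs lst).
have cn : c <= n.
  rewrite -lst; move: pcs; rewrite (path_sortedE leq_trans) => /andP[/allP h _].
  by have := mem_last c s; rewrite inE => /predU1P[->|/h].
set B := [set j : 'I_n | a <= j < c].
have cB : #|B| = (c - a)%N.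
  have -> : B = initial_segment n c :\: initial_segment n a.
    by apply/setP => j; rewrite !inE -leqNgt.
  rewrite cardsD (setIidPr _) ?card_initial_segment ?(leq_trans ac) //.
  by apply/subsetP => j; rewrite !inE => /leq_trans; apply.
have <- : #|[set u : 'S_n | perm_on B u]| = (c - a)`!.
  by rewrite -cB -card_perm; apply: eq_card => u; rewrite inE.
rewrite -cardsX.
set P := setX _ _.
have fixu (u : 'S_n) (j : 'I_n) : perm_on B u -> ~~ (a <= j < c) -> u j = j.
  by move=> hu hj; rewrite (out_perm hu) // inE.
have inu (u : 'S_n) (j : 'I_n) : perm_on B u -> (a <= u j < c) = (a <= j < c).
  by move=> hu; have := perm_closed j hu; rewrite !inE.
have fixv (v : 'S_n) (b : nat) (j : 'I_n) :
    perm_on [set j : 'I_n | b <= j] v -> j < b -> v j = j.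
  by move=> hv hj; rewrite (out_perm hv) // inE -ltnNge.
have inv (v : 'S_n) (b : nat) (j : 'I_n) :
    perm_on [set j : 'I_n | b <= j] v -> (b <= v j) = (b <= j).
  by move=> hv; have := perm_closed j hv; rewrite !inE.
have sge d : d \in s -> c <= d.
  by move: pcs; rewrite (path_sortedE leq_trans) => /andP[/allP h _] /h.
have ustab u d : perm_on B u -> c <= d -> u \in segment_stab n d.
  move=> hu cd; apply/segment_stabP => j.
  case/boolP: (a <= j < c) => [hj|/(fixu u _ hu) -> //].
  by have := inu u j hu; rewrite hj; lia.
rewrite -(card_in_imset (f := fun p : 'S_n * 'S_n => p.1 * p.2) (D := P)).
  congr #|pred_of_set _|; apply/setP => w; rewrite in_set.
  apply/andP/imsetP => [[hw /andP[wc /allP ws]]|[[u v] /=]]; last first.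
    case/setXP=> /=; rewrite in_set => hu; rewrite in_set => /andP[hv /allP vs] ->; split.
      apply/subsetP => j; rewrite !inE permM; apply: contraNleq => ja.
      by rewrite (fixu u) ?(fixv v c) //; lia.
    apply/andP; split; last first.
      by apply/allP => d ds; rewrite groupM ?vs ?ustab ?sge.
    rewrite groupM ?(ustab u) //; apply/segment_stabP => j.
    by have := inv v c j hv; lia.
  have wB : w \in 'N(B | 'P).
    apply/astabsP => j; rewrite !inE /aperm.
    by move/segment_stabP: wc => ->; rewrite inv.
  (* [u] agrees with [w] on [B], and both fix what lies below [a]; hence [u^-1 * w] fixes everything
     below [c]. *)
  set u := restr_perm B w.
  have hu : perm_on B u by apply: restr_perm_on.
  have uw (j : 'I_n) : j < c -> u j = w j.
    move=> jc; case: (leqP a j) => ja; first by rewrite restr_permE // inE ja jc.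
    by rewrite (fixu u) ?(fixv w a) //; lia.
  have uVB : perm_on B u^-1 by apply: perm_onV.
  exists (u, u^-1 * w); last by rewrite /= mulKVg.
  rewrite !inE /= hu /=; apply/andP; split; last first.
    by apply/allP => d ds; rewrite groupM ?ws // groupV ustab ?sge.
  apply/subsetP => j; rewrite !inE permM; apply: contraNleq => jc.
  rewrite -uw ?permKV //.
  by have /segment_stabP -> := ustab _ c uVB (leqnn c).
move=> [u v] [u' v']; rewrite !inE /= => /and3P[hu hv _] /and3P[hu' hv' _] e.
suff uu' : u = u' by move: e; rewrite uu' => /mulgI ->.
(* Since [v] and [v'] fix everything below [c], both products restrict on [B] to their first
   factors. *)
apply/permP => j; case/boolP: (a <= j < c) => hj; last by rewrite !fixu.
have := congr1 (fun f : 'S_n => f j) e; rewrite !permM.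
rewrite (fixv v c) ?(fixv v' c) //.
  by have := inu u' j hu'; rewrite hj => /andP[].
by have := inu u j hu; rewrite hj => /andP[].
Qed.

Lemma card_young n (X : {set 'I_n.-1}) : #|young X| = eta X.
Proof.
rewrite /eta -(@card_segment_stabs n).
- apply: eq_card => w; rewrite inE.
  have -> : perm_on [set j : 'I_n | 0 <= j] w by apply/subsetP => j; rewrite inE.
  rewrite /= all_rcons; apply/bigcapP/andP => [h|[_ /allP h] i iX].
    (* The final cut [n] is preserved by every permutation. *)
    split; first by apply/segment_stabP => j; rewrite !ltn_ord.
    by apply/allP => _ /mapP[i + ->]; rewrite mem_enum => /h.
  by apply: h; apply/mapP; exists i; rewrite ?mem_enum.
- rewrite (path_sortedE leq_trans); apply/andP; split; first exact/allP.
  have s1 : sorted leq [seq i.+1 | i : 'I_n.-1 <- enum X].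
    rewrite (map_comp S val) sorted_map.
    apply: (sub_sorted (e := ltn)); first by move=> x y; apply: ltnW.
    rewrite sorted_map {1}/enum_mem.
    apply: sorted_filter; first by move=> x y z; apply: ltn_trans.
    by rewrite -sorted_map -enumT val_enum_ord iota_ltn_sorted.
  move: s1; rewrite !sorted_pairwise ?pairwise_rcons; try exact: leq_trans.
  by move=> ->; rewrite andbT; apply/allP => _ /mapP[i _ ->]; have := ltn_ord i; rewrite ltn_predRL => /ltnW.
by rewrite last_rcons.
Qed.

(** * Coset representatives with prescribed descents *)

(** Induction gives [j <= g j] for all [j]. Hence [g^-1] maps every initial segment into itself, so
    [g] preserves them all and [g j <= j]. *)
Lemma perm_increasing_eq1 n (g : 'S_n) :
  (forall i : 'I_n.-1, g (pos i) < g (succ_pos i)) -> g = 1.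
Proof.
move=> h.
have le_g (m : nat) (j : 'I_n) : j = m :> nat -> j <= g j.
  elim: m j => [|m IH] j jm; first by rewrite jm.
  have mn : m < n.-1 by have := ltn_ord j; lia.
  have -> : j = succ_pos (Ordinal mn) by apply: val_inj.
  by apply: leq_ltn_trans (h _); apply: IH.
apply/permP => j; rewrite perm1; apply: val_inj; apply/eqP.
rewrite eqn_leq (le_g j) // andbT -ltnS.
suff /segment_stabP -> : g \in segment_stab n j.+1 by [].
rewrite -groupV; apply: segment_stab_sub => k; apply: leq_ltn_trans.
by have := le_g _ (g^-1 k) erefl; rewrite permKV.
Qed.

Lemma descent_run n (T : {set 'I_n.-1}) (w : 'S_n) (a b : 'I_n) :
  T \subset descent_set w -> a < b ->
  (forall k : 'I_n.-1, a <= k < b -> k \in T) -> w b < w a.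
Proof.
move=> /subsetP hT; move eb: (nat_of_ord b) => m.
elim: m b eb => // m IH b bm am h.
have mn : m < n.-1 by have := ltn_ord b; lia.
have /hT : Ordinal mn \in T by apply: h => /=; lia.
have -> : b = succ_pos (Ordinal mn) by apply: val_inj.
rewrite inE => lt_b; move: am; rewrite ltnS leq_eqVlt => /predU1P[ea|am].
  by have -> : a = pos (Ordinal mn) by apply: val_inj.
apply: ltn_trans lt_b _; apply: IH => // k hk.
by apply: h; lia.
Qed.

(** The product [g * m] applies [g] first, so it rearranges the entries of [m] within the blocks.
    The proof shows that [g] increases at each adjacent pair: a pair split by a cut outside [T]
    keeps its order, and inside a block a reversal by [g] would turn the descent of [m] into an
    ascent of [g * m]. *)
Lemma young_coset_descent_uniq n (T : {set 'I_n.-1}) (m g : 'S_n) :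
  g \in young (~: T) -> T \subset descent_set m ->
  T \subset descent_set (g * m) -> g = 1.
Proof.
move=> /youngP hg hm /subsetP hgm; apply: perm_increasing_eq1 => i.
case: (boolP (i \in T)) => iT; last first.
  have iX : i \in ~: T by rewrite inE.
  have := hg i iX (pos i); have := hg i iX (succ_pos i); rewrite /= leqnn ltnn.
  by move=> /negbT; rewrite -ltnNge => h1 h2; apply: leq_ltn_trans h1.
have := hgm _ iT; rewrite inE !permM => lt_m.
case: ltngtP => // [lt_g|/val_inj/perm_inj/(congr1 val)/=]; last by lia.
suff : m (g (pos i)) < m (g (succ_pos i)) by lia.
(* A cut outside [T] between the two images would, being preserved by [g], also put [succ_pos i]
   before [pos i]. *)
apply: (descent_run hm lt_g) => k /andP[k1 k2].
apply/negPn/negP => kT; have kX : k \in ~: T by rewrite inE.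
by have := hg k kX (succ_pos i); have := hg k kX (pos i) => /=; lia.
Qed.

(** Only the cut at [i] separates the two positions, and it is not among the cuts of [~: T]. *)
Lemma tperm_young n (T : {set 'I_n.-1}) (i : 'I_n.-1) :
  i \in T -> tperm (pos i) (succ_pos i) \in young (~: T).
Proof.
move=> iT; apply/youngP => k; rewrite inE => kT j.
have ki : k != i :> nat by apply: contraNneq kT => /val_inj ->.
by case: tpermP => [->|->|//] /=; lia.
Qed.

(* A coset representative minimizing [\sum_j j * w j] has no ascent in [T], as
   exchanging the two entries of an ascent would decrease the sum. *)
Lemma young_coset_descent_exists n (T : {set 'I_n.-1}) (w : 'S_n) :
  exists2 g, g \in young (~: T) & T \subset descent_set (g * w).
Proof.
pose F (g : 'S_n) := (\sum_(j < n) j * (g * w)%g j)%N.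
case: (@arg_minnP _ 1 [in young (~: T)] F (group1 _)) => g /= hg min_g.
exists g => //; apply/subsetP => i iT; rewrite inE ltnNge; apply/negP => le_i.
set p := pos i; set q := succ_pos i; set t := tperm p q.
have npq : q != p by apply/eqP => /(congr1 val) /=; lia.
have {le_i} : (g * w)%g p < (g * w)%g q.
  rewrite ltn_neqAle le_i andbT; apply: contra npq => /eqP/val_inj/perm_inj ->.
  by [].
have := min_g (t * g) (groupM (tperm_young iT) hg).
rewrite /F (bigD1 p) // (bigD1 q) //= [X in _ <= X](bigD1 p) //.
rewrite [X in _ <= _ + X](bigD1 q) //=.
rewrite [X in _ <= _ + (_ + X)](eq_bigr (fun j : 'I_n => j * (g * w)%g j)%N).
  rewrite -mulgA !(permM t) tpermL tpermR /= !mulSn.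
  by move: (\sum_(j < n | _) _)%N (nat_of_ord ((g * w)%g p))
    (nat_of_ord ((g * w)%g q)) => s A B; lia.
by move=> j /andP[jp jq]; rewrite -mulgA (permM t) tpermD // 1?eq_sym.
Qed.

(** * The index count and the quotient formula *)

(** The map sending [(m, g)] to [g * m] is a bijection onto [young (~: S)]: existence of a
    decreasing coset representative makes it onto, uniqueness makes it injective. *)
Lemma A_ST_mul_eta n (S T : {set 'I_n.-1}) :
  T \subset S -> (A_ST S T * eta (~: T))%N = eta (~: S).
Proof.
move=> TS; have /subsetP YTS : young (~: T) \subset young (~: S).
  by apply: youngS; rewrite setCS.
rewrite -!card_young /A_ST -cardsX.
rewrite -(card_in_imset (f := fun p : 'S_n * 'S_n => p.2 * p.1)).
  apply: eq_card => w; apply/imsetP/idP => [[[m g] /=]|hw].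
    rewrite !inE -youngE /= => /andP[/andP[hm _] hg] ->.
    by rewrite groupM ?(YTS g).
  have [g hg hgw] := young_coset_descent_exists T w.
  exists (g * w, g^-1); last by rewrite /= mulKg.
  by rewrite !inE -youngE /= groupV hg hgw groupM ?(YTS g).
move=> [m g] [m' g']; rewrite !inE /= => /andP[/andP[_ hm] hg].
move=> /andP[/andP[_ hm'] hg'] e.
have em : m = (g^-1 * g') * m' by rewrite -mulgA -e mulKg.
have /eqP : g^-1 * g' = 1.
  by apply: (young_coset_descent_uniq _ hm'); rewrite -?em // groupM ?groupV.
rewrite -eq_mulVg1 => /eqP gg'.
by move: em; rewrite gg' mulVg mul1g => ->.
Qed.

Theorem theorem1p2 (n : nat) (hn : (1 <= n)%N) (S T : {set 'I_n.-1}) :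
  (~: S :&: T = set0 ->
     ((A_ST S T)%:R = (eta (~: S))%:R / (eta (~: T))%:R :> rat)%R)
  /\ (~: S :&: T <> set0 -> A_ST S T = 0%N).
Proof.
split=> [/eqP ST0|/eqP/set0Pn[i]].
  have TS : T \subset S.
    by rewrite -[S]setCK -disjoints_subset disjoint_sym -setI_eq0 ST0.
  rewrite -(A_ST_mul_eta TS) GRing.natrM GRing.mulfK //.
  (* The divisor is nonzero because it is the order of a group. *)
  by rewrite Num.Theory.pnatr_eq0 -card_young -lt0n cardG_gt0.
(* At a common index, connectivity forces an ascent and [T] forces a descent. *)
rewrite inE => /andP[iS iT]; apply/eqP; rewrite cards_eq0; apply/eqP/setP => w.
rewrite !inE; apply/negP => /andP[/subsetP/(_ _ iS) + /subsetP/(_ _ iT)].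
rewrite !inE => /forallP/(_ (pos i))/forallP/(_ (succ_pos i))/implyP h.
by have := h _; rewrite /= leqnn ltnSn => /(_ isT) /ltn_trans lt /lt; rewrite ltnn.
Qed.
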